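(* Let $\gamma:\mathbb{S}^1\to\mathbb{R}$ have one-homogeneous extension $\gamma(\boldsymbol{p})$ and suppose $$3\gamma(\boldsymbol{n})>\gamma(-\boldsymbol{n})\quad\forall \boldsymbol{n}\in\mathbb{S}^1,\qquad \gamma(\boldsymbol{p})\in C^2(\mathbb{R}^2\setminus\{\boldsymbol{0}\}).$$ Let $k_0$ be the minimal stabilizing function of $\gamma$, and let $k:\mathbb{S}^1\to\mathbb{R}$ be a stabilizing function with $k(\boldsymbol{n})\ge k_0(\boldsymbol{n})$ for all $\boldsymbol{n}\in\mathbb{S}^1$. Let $\tau>0$, let $\boldsymbol{X}^0\in[\mathbb{K}^h]^2$ be given by $\boldsymbol{X}^0(\rho_j)=\boldsymbol{X}_0(\rho_j)$, $0\le j\le N$, for an initial closed curve $\boldsymbol{X}_0:\mathbb{T}\to\mathbb{R}^2$, and let $(\boldsymbol{X}^{m+1},\mu^{m+1})\in[\mathbb{K}^h]^2\times\mathbb{K}^h$, $m=0,1,2,\ldots$, satisfy the scheme (SP-PFEM for anisotropic surface diffusion) $$\Bigl(\boldsymbol{n}^{m+\frac12}\cdot\frac{\boldsymbol{X}^{m+1}-\boldsymbol{X}^m}{\tau},\varphi^h\Bigr)^h_{\Gamma^m}+\Bigl(\partial_s\mu^{m+1},\partial_s\varphi^h\Bigr)^h_{\Gamma^m}=0\quad\forall\varphi^h\in\mathbb{K}^h,$$ $$\Bigl(\mu^{m+1}\boldsymbol{n}^{m+\frac12},\boldsymbol{\omega}^h\Bigr)^h_{\Gamma^m}-\Bigl(\boldsymbol{G}_k(\boldsymbol{n}^m)\partial_s\boldsymbol{X}^{m+1},\partial_s\boldsymbol{\omega}^h\Bigr)^h_{\Gamma^m}=0\quad\forall\boldsymbol{\omega}^h\in[\mathbb{K}^h]^2,$$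 where $\min_{1\le j\le N}|\boldsymbol{h}_j^m|>0$ for all $m\ge0$. Then $$A^{m+1}= A^0,\qquad W^{m+1}\le W^m\le\cdots\le W^0,\qquad\forall m\ge0.$$
   Context: Rotation: for $\boldsymbol{v}=(v_1,v_2)^T\in\mathbb{R}^2$, $\boldsymbol{v}^\perp=(v_2,-v_1)^T$ (clockwise rotation by $\pi/2$). Anisotropy: the one-homogeneous extension of $\gamma$ is $\gamma(\boldsymbol{p})=|\boldsymbol{p}|\gamma(\boldsymbol{p}/|\boldsymbol{p}|)$ for $\boldsymbol{p}\ne\boldsymbol{0}$, $\gamma(\boldsymbol{0})=0$. The Cahn–Hoffman vector is $\boldsymbol{\xi}=\boldsymbol{\xi}(\boldsymbol{n})=\nabla\gamma(\boldsymbol{p})|_{\boldsymbol{p}=\boldsymbol{n}}$, $\boldsymbol{n}\in\mathbb{S}^1$. For a nonnegative function $k:\mathbb{S}^1\to\mathbb{R}$ (the stabilizing function), the surface energy matrix is $\boldsymbol{G}_k(\boldsymbol{n})=\gamma(\boldsymbol{n})I_2-\boldsymbol{n}\boldsymbol{\xi}^T+\boldsymbol{\xi}\boldsymbol{n}^T+k(\boldsymbol{n})\boldsymbol{n}\boldsymbol{n}^T$. Minimal stabilizing function: for $\boldsymbol{n},\hat{\boldsymbol{n}}\in\mathbb{S}^1$, $\alpha\ge0$, let $P_\alpha(\boldsymbol{n},\hat{\boldsymbol{n}})=2\sqrt{(\gamma(\boldsymbol{n})+\alpha(\hat{\boldsymbol{n}}\cdot\boldsymbol{n}^\perp)^2)\gamma(\boldsymbol{n})}$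 and $Q(\boldsymbol{n},\hat{\boldsymbol{n}})=\gamma(\hat{\boldsymbol{n}})+\gamma(\boldsymbol{n})(\boldsymbol{n}\cdot\hat{\boldsymbol{n}})-(\boldsymbol{\xi}(\boldsymbol{n})\cdot\boldsymbol{n}^\perp)(\hat{\boldsymbol{n}}\cdot\boldsymbol{n}^\perp)$. Then $k_0(\boldsymbol{n})=\inf\{\alpha\ge0:\ P_\alpha(\boldsymbol{n},\hat{\boldsymbol{n}})-Q(\boldsymbol{n},\hat{\boldsymbol{n}})\ge0\ \ \forall\hat{\boldsymbol{n}}\in\mathbb{S}^1\}$. Discretization: $\mathbb{T}=\mathbb{R}/\mathbb{Z}=[0,1]$ (periodic), $N>2$ an integer, $h=1/N$, $\rho_j=jh$ for $0\le j\le N$ (with $\rho_N=\rho_0$ by periodicity), $I_j=[\rho_{j-1},\rho_j]$. $\mathbb{K}^h=\{u\in C(\mathbb{T}):u|_{I_j}\text{ is a polynomial of degree}\le1,\ 1\le j\le N\}$. For $\boldsymbol{X}^m=(x^m,y^m)^T\in[\mathbb{K}^h]^2$, $\Gamma^m=\boldsymbol{X}^m(\mathbb{T})$ is a closed polygonal curve and $\boldsymbol{h}_j^m=\boldsymbol{X}^m(\rho_j)-\boldsymbol{X}^m(\rho_{j-1})$. The normal is the piecewise constant vector $\boldsymbol{n}^m|_{I_j}=\boldsymbol{n}_j^m=-(\boldsymbol{h}_j^m)^\perp/|\boldsymbol{h}_j^m|$, and $\boldsymbol{G}_k(\boldsymbol{n}^m)|_{I_j}=\boldsymbol{G}_k(\boldsymbol{n}_j^m)$.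 Further, $\boldsymbol{n}^{m+\frac12}=-\frac{1}{2|\partial_\rho\boldsymbol{X}^m|}(\partial_\rho\boldsymbol{X}^m+\partial_\rho\boldsymbol{X}^{m+1})^\perp$, i.e. $\boldsymbol{n}^{m+\frac12}|_{I_j}=-\frac{(\boldsymbol{h}_j^m+\boldsymbol{h}_j^{m+1})^\perp}{2|\boldsymbol{h}_j^m|}$. For scalar or vector functions $f$ on $\Gamma^m$, $\partial_sf|_{I_j}=\frac{f(\rho_j)-f(\rho_{j-1})}{|\boldsymbol{h}_j^m|}$. The mass-lumped inner product of (possibly discontinuous at the $\rho_j$) scalar or vector functions is $(u,v)^h_{\Gamma^m}=\frac12\sum_{j=1}^N|\boldsymbol{h}_j^m|\bigl((u\cdot v)(\rho_{j-1}^+)+(u\cdot v)(\rho_j^-)\bigr)$, with one-sided limits. Discrete area and energy: $A^m=\frac12\sum_{j=1}^N(x^m(\rho_j)-x^m(\rho_{j-1}))(y^m(\rho_j)+y^m(\rho_{j-1}))$, $W^m=\sum_{j=1}^N|\boldsymbol{h}_j^m|\gamma(\boldsymbol{n}_j^m)$. *)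

(* Defs.v *)
From Stdlib Require Import Reals.
From Coquelicot Require Import Coquelicot.
Open Scope R_scope.

(** Points of R^2 are pairs, with Coquelicot's [plus], [minus], [opp], [scal].
    A 2x2 matrix is the pair of its rows, with the same operations. *)
Definition vec : Type := (R * R)%type.
Definition mat : Type := (vec * vec)%type.

Definition dot (u v : vec) : R := fst u * fst v + snd u * snd v.
Definition vnorm (v : vec) : R := sqrt (dot v v).
Definition perp (v : vec) : vec := (snd v, - fst v).
Definition unit_circle (v : vec) : Prop := vnorm v = 1.

Definition id2 : mat := ((1, 0), (0, 1)).
Definition outer (u v : vec) : mat := (scal (fst u) v, scal (snd u) v).
Definition mulmv (M : mat) (v : vec) : vec := (dot (fst M) v, dot (snd M) v).

(** A function on the unit circle is a function on [vec] of which only the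
    values at unit vectors are ever used. *)

(** At the origin the factor [vnorm p] makes this 0. *)
Definition hom_ext (gamma : vec -> R) (p : vec) : R :=
  vnorm p * gamma (scal (/ vnorm p) p).

Definition C2_off_origin (f : vec -> R) : Prop :=
  forall x y : R, (x, y) <> (0, 0) -> ex_diff_n (fun u v => f (u, v)) 2 x y.

Definition grad (f : vec -> R) (p : vec) : vec :=
  (Derive (fun x => f (x, snd p)) (fst p), Derive (fun y => f (fst p, y)) (snd p)).

(** Cahn-Hoffman vector *)
Definition xi (gamma : vec -> R) (n : vec) : vec := grad (hom_ext gamma) n.

(** Surface energy matrix *)
Definition Gmat (gamma k : vec -> R) (n : vec) : mat :=
  plus (plus (minus (scal (gamma n) id2) (outer n (xi gamma n)))
             (outer (xi gamma n) n))
       (scal (k n) (outer n n)).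

Definition Pfun (gamma : vec -> R) (alpha : R) (n n' : vec) : R :=
  2 * sqrt ((gamma n + alpha * dot n' (perp n) ^ 2) * gamma n).

Definition Qfun (gamma : vec -> R) (n n' : vec) : R :=
  gamma n' + gamma n * dot n n' - dot (xi gamma n) (perp n) * dot n' (perp n).

(** Minimal stabilizing function. [real] sends the infimum of the empty set
    to 0; the set is bounded below by 0, so -oo does not occur. *)
Definition k0 (gamma : vec -> R) (n : vec) : R :=
  real (Glb_Rbar (fun alpha => 0 <= alpha /\
    forall n', unit_circle n' -> 0 <= Pfun gamma alpha n n' - Qfun gamma n n')).

(** Functions on R/Z are 1-periodic functions on R. *)
Definition periodic1 {V : Type} (u : R -> V) : Prop := forall r, u (r + 1) = u r.

Definition node (N j : nat) : R := INR j * / INR N.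

Definition Kh (N : nat) (u : R -> R) : Prop :=
  periodic1 u /\ (forall r, continuous u r) /\
  forall j, (1 <= j <= N)%nat ->
    exists a b, forall r, node N (j - 1) <= r <= node N j -> u r = a + b * r.

Definition Kh2 (N : nat) (X : R -> vec) : Prop :=
  Kh N (fun r => fst (X r)) /\ Kh N (fun r => snd (X r)).

Definition edge (N : nat) (X : R -> vec) (j : nat) : vec :=
  minus (X (node N j)) (X (node N (j - 1))).

(** The 1-periodic function equal to [c j] on [[node N (j-1), node N j)],
    [1 <= j <= N]. Its values at the nodes are a convention without effect, since
    only one-sided limits there enter the inner product. *)
Definition piecewise {V : Type} (N : nat) (c : nat -> V) (r : R) : V :=
  c (S (Z.to_nat (Int_part (INR N * frac_part r)))).

Definition normal (N : nat) (X : R -> vec) (j : nat) : vec :=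
  scal (/ vnorm (edge N X j)) (opp (perp (edge N X j))).

(** For [X] = X^m and [Y] = X^(m+1), this is n^(m+1/2) *)
Definition half_normal (N : nat) (X Y : R -> vec) : R -> vec :=
  piecewise N (fun j =>
    opp (scal (/ (2 * vnorm (edge N X j))) (perp (plus (edge N X j) (edge N Y j))))).

(** Arc-length derivative with respect to the curve [X] *)
Definition ds {V : ModuleSpace R_Ring} (N : nat) (X : R -> vec) (f : R -> V) : R -> V :=
  piecewise N (fun j =>
    scal (/ vnorm (edge N X j)) (minus (f (node N j)) (f (node N (j - 1))))).

Definition rlim (f : R -> R) (r : R) : R :=
  iota (fun l : R => filterlim f (at_right r) (locally l)).
Definition llim (f : R -> R) (r : R) : R :=
  iota (fun l : R => filterlim f (at_left r) (locally l)).

(** Mass-lumped quadrature on the curve [X] *)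
Definition lumped (N : nat) (X : R -> vec) (f : R -> R) : R :=
  / 2 * sum_n_m (fun j => vnorm (edge N X j) *
                   (rlim f (node N (j - 1)) + llim f (node N j))) 1 N.

Definition inner_s (N : nat) (X : R -> vec) (u v : R -> R) : R :=
  lumped N X (fun r => u r * v r).
Definition inner_v (N : nat) (X : R -> vec) (u v : R -> vec) : R :=
  lumped N X (fun r => dot (u r) (v r)).

(** One time step of the scheme, from [X] to [(Y, mu)] *)
Definition scheme_step (N : nat) (gamma k : vec -> R) (tau : R)
    (X Y : R -> vec) (mu : R -> R) : Prop :=
  (forall phi : R -> R, Kh N phi ->
     inner_s N X (fun r => dot (half_normal N X Y r) (scal (/ tau) (minus (Y r) (X r)))) phi
     + inner_s N X (ds N X mu) (ds N X phi) = 0) /\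
  (forall omega : R -> vec, Kh2 N omega ->
     inner_v N X (fun r => scal (mu r) (half_normal N X Y r)) omega
     - inner_v N X (fun r => mulmv (piecewise N (fun j => Gmat gamma k (normal N X j)) r)
                                   (ds N X Y r))
                   (ds N X omega) = 0).

Definition area (N : nat) (X : R -> vec) : R :=
  / 2 * sum_n_m (fun j => (fst (X (node N j)) - fst (X (node N (j - 1)))) *
                          (snd (X (node N j)) + snd (X (node N (j - 1))))) 1 N.

Definition energy (N : nat) (gamma : vec -> R) (X : R -> vec) : R :=
  sum_n_m (fun j => vnorm (edge N X j) * gamma (normal N X j)) 1 N.

(* Main.v *)
Require Import Defs.
From Stdlib Require Import Reals ZArith Lra Lia.
From Coquelicot Require Import Coquelicot.
Open Scope R_scope.

(** Testing the first equation with [1] gives area conservation, because the mean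
    normal makes the sum over the edges of [n^(m+1/2) . (X^(m+1) - X^m)] equal to
    the increment of the area, up to a telescoping sum along the closed polygon.
    Testing with [mu] and with [X^(m+1) - X^m] gives dissipation: on each edge the
    elastic term is [L'^2 / L (gamma + k s^2) - L' (Q - gamma')], which by AM-GM and
    [Q <= P_k] is at least the increment [L' gamma' - L gamma] of the energy.

    The inequality [Q <= P_k] follows from [k >= k0] once the set defining [k0] is
    known to be nonempty. This needs a bound [Q <= 2 gamma + B s^2] on the circle,
    with [s] the component of the second normal orthogonal to the first: near [n]
    it is a second order Taylor expansion, near [-n] it is the strict inequality
    [gamma (-n) - gamma n < 2 gamma n], and elsewhere [s^2] is bounded below. *)

(** * The minimal stabilizing function *)

Lemma unit_circle_iff (v : vec) : unit_circle v <-> fst v * fst v + snd v * snd v = 1.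
Proof.
  unfold unit_circle, vnorm, dot. split; intros H.
  - rewrite <- (sqrt_sqrt (fst v * fst v + snd v * snd v)) by nra.
    rewrite H. ring.
  - rewrite H. apply sqrt_1.
Qed.

Lemma vnorm_sq (v : vec) : vnorm v * vnorm v = fst v * fst v + snd v * snd v.
Proof. unfold vnorm, dot. apply sqrt_sqrt. nra. Qed.

Lemma vnorm_scal (c : R) (v : vec) : 0 <= c -> vnorm (scal c v) = c * vnorm v.
Proof.
  intros Hc. unfold vnorm, dot.
  change (fst (scal c v)) with (c * fst v).
  change (snd (scal c v)) with (c * snd v).
  replace (_ + _) with ((c * c) * (fst v * fst v + snd v * snd v)) by ring.
  rewrite sqrt_mult by nra. now rewrite sqrt_square.
Qed.

Lemma hom_ext_unit (gamma : vec -> R) (n : vec) :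
  unit_circle n -> hom_ext gamma n = gamma n.
Proof.
  intros H. unfold hom_ext. rewrite H, Rinv_1, Rmult_1_l. f_equal.
  apply (scal_one n).
Qed.

Lemma hom_ext_scal (gamma : vec -> R) (c : R) (p : vec) :
  0 < c -> hom_ext gamma (scal c p) = c * hom_ext gamma p.
Proof.
  intros Hc. unfold hom_ext. rewrite vnorm_scal by lra.
  destruct (Req_dec (vnorm p) 0) as [H0 | H0].
  - rewrite H0. ring.
  - rewrite Rmult_assoc, scal_assoc.
    replace (mult _ c) with (/ vnorm p); [reflexivity |].
    unfold mult; simpl. field. auto with real.
Qed.

(** The hypothesis at [n] and at [opp n] chains to [9 * gamma n > 3 * gamma (opp n) > gamma n]. *)
Lemma gamma_pos (gamma : vec -> R) (n : vec) :
  (forall n, unit_circle n -> 3 * gamma n > gamma (opp n)) ->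
  unit_circle n -> 0 < gamma n.
Proof.
  intros H Hn.
  assert (Hn' : unit_circle (opp n)).
  { apply unit_circle_iff. apply unit_circle_iff in Hn. simpl.
    unfold opp; simpl. lra. }
  pose proof (H n Hn). pose proof (H _ Hn') as H2. rewrite opp_opp in H2. lra.
Qed.

(** * Quadratic upper bounds for [Qfun] on the circle *)

(** The circle is the union of the graphs of [sqrt (1 - t * t)] and its negative over [[-1, 1]];
    along each, [f] is a continuous function on a compact interval and attains its maximum. *)
Lemma bounded_on_circle (f : R -> R -> R) :
  (forall x y, (x, y) <> (0, 0) -> continuity_2d_pt f x y) ->
  exists M, forall x y, x * x + y * y = 1 -> f x y <= M.
Proof.
  intros Hf.
  assert (arc : forall e, e * e = 1 -> exists M, forall t, -1 <= t <= 1 ->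
            f t (e * sqrt (1 - t * t)) <= M).
  { intros e He.
    destruct (continuity_ab_maj (fun t => f t (e * sqrt (1 - t * t))) (-1) 1)
      as [m [Hm _]]; [lra | | now exists (f m (e * sqrt (1 - m * m)))].
    intros t Ht. apply continuity_pt_filterlim.
    apply (continuous_comp_2 (fun t : R => t) (fun t => e * sqrt (1 - t * t)) f).
    - apply continuous_id.
    - apply (continuous_mult (K := R_AbsRing) (fun _ => e)).
      + apply continuous_const.
      + apply continuous_comp; [| apply continuous_sqrt].
        apply (ex_derive_continuous (fun t : R => 1 - t * t)). now auto_derive.
    - apply continuity_2d_pt_filterlim, Hf. intros E. injection E as E1 E2.
      rewrite E1 in E2. replace (1 - 0 * 0) with 1 in E2 by ring.
      rewrite sqrt_1 in E2. nra. }
  destruct (arc 1) as [M1 H1]; [ring |].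
  destruct (arc (-1)) as [M2 H2]; [ring |].
  exists (Rmax M1 M2). intros x y Hxy.
  assert (Hx : -1 <= x <= 1) by nra.
  destruct (Rle_dec 0 y) as [Hy | Hy].
  - apply Rle_trans with M1; [| apply Rmax_l].
    replace y with (1 * sqrt (1 - x * x)); [now apply H1 |].
    replace (1 - x * x) with (y * y) by lra. rewrite sqrt_square; lra.
  - apply Rle_trans with M2; [| apply Rmax_r].
    replace y with (-1 * sqrt (1 - x * x)); [now apply H2 |].
    replace (1 - x * x) with (- y * - y) by lra. rewrite sqrt_square; lra.
Qed.

Lemma off_origin_near_circle (a b : R) :
  a * a + b * b = 1 -> locally_2d (fun u v => (u, v) <> (0, 0)) a b.
Proof.
  intros Hab. exists (mkposreal (1 / 2) ltac:(lra)). simpl.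
  intros u v Hu Hv E. injection E as -> ->.
  apply Rabs_def2 in Hu. apply Rabs_def2 in Hv. nra.
Qed.

Lemma taylor_at_unit (gamma : vec -> R) (a b : R) :
  C2_off_origin (hom_ext gamma) -> a * a + b * b = 1 ->
  exists D, 0 <= D /\ locally_2d (fun u v =>
    hom_ext gamma (u, v) <= gamma (a, b) + dot (xi gamma (a, b)) (u - a, v - b)
      + D * Rmax (Rabs (u - a)) (Rabs (v - b)) ^ 2) a b.
Proof.
  intros HC Hab.
  destruct (Taylor_Lagrange_2d (fun u v => hom_ext gamma (u, v)) 1 a b) as [D HD].
  { apply locally_2d_impl with (2 := off_origin_near_circle a b Hab).
    apply locally_2d_forall. intros u v. apply HC. }
  (* The Taylor remainder constant comes without a sign; later estimates multiply by it and need it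
     nonnegative. *)
  exists (Rmax D 0). split; [apply Rmax_r |].
  apply locally_2d_impl with (2 := HD). apply locally_2d_forall. intros u v H.
  assert (E : DL_pol 1 (fun u v => hom_ext gamma (u, v)) a b (u - a) (v - b)
    = gamma (a, b) + dot (xi gamma (a, b)) (u - a, v - b)).
  { rewrite <- (hom_ext_unit gamma (a, b)) by (now apply unit_circle_iff).
    unfold DL_pol, differential, partial_derive, Binomial.C, dot, xi, grad.
    simpl. field. }
  rewrite E in H. apply Rabs_le_between in H.
  assert (D * Rmax (Rabs (u - a)) (Rabs (v - b)) ^ 2
          <= Rmax D 0 * Rmax (Rabs (u - a)) (Rabs (v - b)) ^ 2).
  { apply Rmult_le_compat_r; [apply pow2_ge_0 | apply Rmax_l]. }
  simpl in *. lra.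
Qed.

(** This is [Qfun gamma n] with [gamma] replaced by its extension, so that continuity in the plane
    makes sense; the two agree on the circle. *)
Lemma continuity_2d_Qfun (gamma : vec -> R) (n : vec) (x y : R) :
  C2_off_origin (hom_ext gamma) -> (x, y) <> (0, 0) ->
  continuity_2d_pt (fun u v => hom_ext gamma (u, v) + gamma n * dot n (u, v)
    - dot (xi gamma n) (perp n) * dot (u, v) (perp n)) x y.
Proof.
  intros HC Hxy. destruct (HC x y Hxy) as [Hcont _].
  unfold dot; simpl.
  repeat first [ exact Hcont | apply continuity_2d_pt_minus | apply continuity_2d_pt_plus
    | apply continuity_2d_pt_mult | apply continuity_2d_pt_const
    | apply continuity_2d_pt_id1 | apply continuity_2d_pt_id2 ].
Qed.

(* On the half circle around [n], use that the ray through a point meets the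
   tangent line [n + t n^perp] and expand the extension of [gamma] there. *)
Lemma Qfun_bound_near (gamma : vec -> R) (a b : R) :
  C2_off_origin (hom_ext gamma) -> a * a + b * b = 1 -> 0 < gamma (a, b) ->
  exists B d, 0 <= B /\ 0 < d /\ forall x y, x * x + y * y = 1 ->
    0 <= a * x + b * y -> Rabs (x * b - y * a) < d ->
    Qfun gamma (a, b) (x, y) <= 2 * gamma (a, b) + B * (x * b - y * a) ^ 2.
Proof.
  intros HC Hab Hg.
  destruct (taylor_at_unit gamma a b HC Hab) as [D [HD [d Hd]]].
  pose proof (cond_pos d) as Hd0.
  (* With [s] and [c] the components of [(x, y)] along [n^perp] and [n], the bound [1 / 2] on [|s|]
     forces [c >= 1 / 2]. Then [t = s / c] satisfies [|t| <= 2 * |s| < d], so the Taylor bound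
     applies, and its remainder [c * D * t^2] is at most [2 * D * c^2 * t^2 = 2 * D * s^2]. *)
  exists (2 * D), (Rmin (d / 2) (1 / 2)).
  split; [lra |]. split; [apply Rmin_glb_lt; lra |].
  intros x y Hxy Hc Hs.
  assert (Hs1 := Rlt_le_trans _ _ _ Hs (Rmin_l _ _)).
  assert (Hs2 := Rlt_le_trans _ _ _ Hs (Rmin_r _ _)).
  set (s := x * b - y * a) in *. set (c := a * x + b * y) in *.
  assert (Hcs : c * c + s * s = 1).
  { unfold c, s. transitivity ((a * a + b * b) * (x * x + y * y)); [ring |].
    rewrite Hab, Hxy; ring. }
  assert (Hcs' : s * s < 1 / 4).
  { apply Rabs_def2 in Hs2. nra. }
  assert (Hc2 : 1 / 2 <= c <= 1) by nra.
  assert (Ht : Rabs (s / c) <= 2 * Rabs s).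
  { unfold Rdiv. rewrite Rabs_mult, Rabs_inv, (Rabs_pos_eq c) by lra.
    rewrite Rmult_comm. apply Rmult_le_compat_r; [apply Rabs_pos |].
    replace 2 with (/ (1 / 2)) by field. apply Rinv_le_contravar; lra. }
  set (t := s / c) in *.
  assert (Hsc : s = t * c) by (unfold t; field; lra).
  assert (Ha : Rabs (t * b) <= Rabs t).
  { rewrite Rabs_mult. rewrite <- (Rmult_1_r (Rabs t)) at 2.
    apply Rmult_le_compat_l; [apply Rabs_pos |]. apply Rabs_le. nra. }
  assert (Hb : Rabs (- (t * a)) <= Rabs t).
  { rewrite Rabs_Ropp, Rabs_mult. rewrite <- (Rmult_1_r (Rabs t)) at 2.
    apply Rmult_le_compat_l; [apply Rabs_pos |]. apply Rabs_le. nra. }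
  assert (HT := Hd (a + t * b) (b - t * a)).
  replace (a + t * b - a) with (t * b) in HT by ring.
  replace (b - t * a - b) with (- (t * a)) in HT by ring.
  specialize (HT ltac:(lra) ltac:(lra)).
  assert (Hm : Rmax (Rabs (t * b)) (Rabs (- (t * a))) ^ 2 <= t * t).
  { replace (t * t) with (Rabs t ^ 2) by (rewrite pow2_abs; ring).
    apply pow_incr. split; [| now apply Rmax_lub].
    apply Rle_trans with (2 := Rmax_l _ _). apply Rabs_pos. }
  assert (Hray : (x, y) = scal c (a + t * b, b - t * a)).
  { unfold scal; simpl. unfold prod_scal, scal; simpl. unfold mult; simpl. f_equal.
    - replace (c * (a + t * b)) with (c * a + t * c * b) by ring. rewrite <- Hsc.
      unfold c, s. transitivity (x * (a * a + b * b)); [rewrite Hab |]; ring.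
    - replace (c * (b - t * a)) with (c * b - t * c * a) by ring. rewrite <- Hsc.
      unfold c, s. transitivity (y * (a * a + b * b)); [rewrite Hab |]; ring. }
  unfold Qfun.
  rewrite <- (hom_ext_unit gamma (x, y)) by (now apply unit_circle_iff).
  rewrite Hray at 1. rewrite hom_ext_scal by lra.
  set (q := dot (xi gamma (a, b)) (perp (a, b))).
  assert (Hq : dot (xi gamma (a, b)) (t * b, - (t * a)) = t * q).
  { unfold q, dot, perp; simpl; ring. }
  rewrite Hq in HT.
  replace (dot (a, b) (x, y)) with c by reflexivity.
  replace (dot (x, y) (perp (a, b))) with s by (unfold s, dot, perp; simpl; ring).
  assert (Hmul : D * Rmax (Rabs (t * b)) (Rabs (- (t * a))) ^ 2 <= D * (t * t))
    by now apply Rmult_le_compat_l.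
  assert (H1 : c * hom_ext gamma (a + t * b, b - t * a)
               <= c * (gamma (a, b) + t * q + D * (t * t))).
  { apply Rmult_le_compat_l; lra. }
  (* The linear terms cancel since [c * t = s], and the two [gamma] terms add up to
     [2 * c * gamma (a, b)] with [c <= 1]; only the remainder is left to compare. *)
  assert (H2 : D * (t * t) * (c * (1 - 2 * c)) <= 0).
  { assert (0 <= D * (t * t)) by (apply Rmult_le_pos; nra). nra. }
  rewrite Hsc. nra.
Qed.

(** At [-n] the value of [Qfun] is [gamma (-n) - gamma n], which lies below [2 * gamma n] by the
    positive gap [e = 3 * gamma n - gamma (-n)]. Continuity preserves the inequality nearby. *)
Lemma Qfun_bound_antipode (gamma : vec -> R) (a b : R) :
  C2_off_origin (hom_ext gamma) -> a * a + b * b = 1 ->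
  3 * gamma (a, b) > gamma (opp (a, b)) ->
  exists d, 0 < d /\ forall x y, x * x + y * y = 1 ->
    a * x + b * y <= 0 -> Rabs (x * b - y * a) < d ->
    Qfun gamma (a, b) (x, y) <= 2 * gamma (a, b).
Proof.
  intros HC Hab H3.
  assert (Hab' : - a * - a + - b * - b = 1) by lra.
  assert (Hne : (- a, - b) <> (0, 0)).
  { intros E. injection E as E1 E2. nra. }
  assert (Hcont := continuity_2d_Qfun gamma (a, b) (- a) (- b) HC Hne).
  set (e := 3 * gamma (a, b) - gamma (opp (a, b))).
  assert (He : 0 < e) by (unfold e; lra).
  destruct (Hcont (mkposreal e He)) as [d Hd]. simpl in Hd.
  pose proof (cond_pos d) as Hd0.
  exists (Rmin (d / 2) 1). split; [apply Rmin_glb_lt; lra |].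
  intros x y Hxy Hc Hs.
  assert (Hs1 := Rlt_le_trans _ _ _ Hs (Rmin_l _ _)).
  assert (Hs2 := Rlt_le_trans _ _ _ Hs (Rmin_r _ _)).
  set (s := x * b - y * a) in *. set (c := a * x + b * y) in *.
  assert (Hcs : c * c + s * s = 1).
  { unfold c, s. transitivity ((a * a + b * b) * (x * x + y * y)); [ring |].
    rewrite Hab, Hxy; ring. }
  assert (Hx : x = c * a + s * b).
  { unfold c, s. transitivity (x * (a * a + b * b)); [rewrite Hab |]; ring. }
  assert (Hy : y = c * b - s * a).
  { unfold c, s. transitivity (y * (a * a + b * b)); [rewrite Hab |]; ring. }
  assert (Hs3 : s * s = Rabs s * Rabs s) by (rewrite <- Rabs_mult, Rabs_pos_eq; nra).
  (* Since [c <= 0], [1 + c] is at most [1 - c^2 = s^2 <= |s|]. Hence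
     [(x, y) + n = (1 + c) n + s n^perp] has coordinates at most [2 * |s| < d]. *)
  assert (Hc1 : 0 <= 1 + c <= Rabs s) by (pose proof (Rabs_pos s); nra).
  assert (Hu : Rabs (x - - a) < d).
  { replace (x - - a) with ((1 + c) * a + s * b) by (rewrite Hx; ring).
    apply Rle_lt_trans with (1 := Rabs_triang _ _). rewrite !Rabs_mult.
    rewrite (Rabs_pos_eq (1 + c)) by lra.
    assert (Rabs a <= 1) by (apply Rabs_le; nra).
    assert (Rabs b <= 1) by (apply Rabs_le; nra).
    pose proof (Rabs_pos a). pose proof (Rabs_pos b). nra. }
  assert (Hv : Rabs (y - - b) < d).
  { replace (y - - b) with ((1 + c) * b + s * - a) by (rewrite Hy; ring).
    apply Rle_lt_trans with (1 := Rabs_triang _ _). rewrite !Rabs_mult, Rabs_Ropp.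
    rewrite (Rabs_pos_eq (1 + c)) by lra.
    assert (Rabs a <= 1) by (apply Rabs_le; nra).
    assert (Rabs b <= 1) by (apply Rabs_le; nra).
    pose proof (Rabs_pos a). pose proof (Rabs_pos b). nra. }
  specialize (Hd x y Hu Hv).
  apply Rabs_def2 in Hd. destruct Hd as [Hd _].
  assert (E1 : hom_ext gamma (- a, - b) = gamma (opp (a, b))).
  { apply (hom_ext_unit gamma (- a, - b)). now apply unit_circle_iff. }
  assert (E2 : dot (a, b) (- a, - b) = - 1) by (unfold dot; simpl; lra).
  assert (E3 : dot (- a, - b) (perp (a, b)) = 0) by (unfold dot; simpl; ring).
  rewrite E1, E2, E3, (hom_ext_unit gamma (x, y)) in Hd
    by (now apply unit_circle_iff).
  unfold Qfun. unfold e in Hd. lra.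
Qed.

Lemma Qfun_bound (gamma : vec -> R) (a b : R) :
  C2_off_origin (hom_ext gamma) -> a * a + b * b = 1 -> 0 < gamma (a, b) ->
  3 * gamma (a, b) > gamma (opp (a, b)) ->
  exists B, 0 <= B /\ forall x y, x * x + y * y = 1 ->
    Qfun gamma (a, b) (x, y) <= 2 * gamma (a, b) + B * (x * b - y * a) ^ 2.
Proof.
  intros HC Hab Hg H3.
  destruct (Qfun_bound_near gamma a b HC Hab Hg) as (B & d1 & HB & Hd1 & H1).
  destruct (Qfun_bound_antipode gamma a b HC Hab H3) as (d2 & Hd2 & H2).
  destruct (bounded_on_circle _
    (fun x y => continuity_2d_Qfun gamma (a, b) x y HC)) as [M HM].
  set (d := Rmin d1 d2).
  assert (Hd : 0 < d) by now apply Rmin_glb_lt.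
  assert (HK : 0 <= Rabs M / (d * d)).
  { apply Rdiv_le_0_compat; [apply Rabs_pos | nra]. }
  (* Away from [n] and [-n], where [s^2 >= d^2], the global bound [M] is absorbed by
     [|M| / d^2 * s^2]. *)
  exists (B + Rabs M / (d * d)). split; [lra |].
  intros x y Hxy. specialize (HM x y Hxy).
  rewrite (hom_ext_unit gamma (x, y)) in HM by (now apply unit_circle_iff).
  pose proof (pow2_ge_0 (x * b - y * a)) as Hs0.
  destruct (Rlt_dec (Rabs (x * b - y * a)) d) as [Hs | Hs].
  - destruct (Rle_dec 0 (a * x + b * y)) as [Hc | Hc].
    + assert (Rabs (x * b - y * a) < d1)
        by (apply Rlt_le_trans with (1 := Hs), Rmin_l).
      specialize (H1 x y Hxy Hc H). nra.
    + assert (Rabs (x * b - y * a) < d2)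
        by (apply Rlt_le_trans with (1 := Hs), Rmin_r).
      specialize (H2 x y Hxy ltac:(lra) H). nra.
  - assert (Hsd : d * d <= (x * b - y * a) ^ 2).
    { rewrite <- pow2_abs. nra. }
    change (Qfun gamma (a, b) (x, y) <= M) in HM.
    pose proof (Rle_abs M).
    assert (Rabs M / (d * d) * (d * d) <= Rabs M / (d * d) * (x * b - y * a) ^ 2)
      by (now apply Rmult_le_compat_l).
    replace (Rabs M / (d * d) * (d * d)) with (Rabs M) in * by (field; lra).
    nra.
Qed.

(** * From the quadratic bound to [Qfun <= Pfun] *)

Lemma stabilizing_exists (gamma : vec -> R) (n : vec) :
  (forall n, unit_circle n -> 3 * gamma n > gamma (opp n)) ->
  C2_off_origin (hom_ext gamma) -> unit_circle n ->
  exists alpha, 0 <= alpha /\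
    forall n', unit_circle n' -> 0 <= Pfun gamma alpha n n' - Qfun gamma n n'.
Proof.
  intros H3 HC Hn. destruct n as [a b].
  assert (Hg := gamma_pos gamma _ H3 Hn). specialize (H3 _ Hn).
  apply unit_circle_iff in Hn; simpl in Hn.
  destruct (Qfun_bound gamma a b HC Hn Hg H3) as (B & HB & HQ).
  set (g := gamma (a, b)) in *.
  (* With [alpha = B + B^2 / (4 g)], the radicand is [g^2 + (g B + B^2 / 4) s^2]. It dominates
     [(g + B s^2 / 2)^2], because [s^4 <= s^2]. *)
  exists ((4 * g * B + B * B) / (4 * g)). split.
  { apply Rdiv_le_0_compat; [| lra].
    apply Rplus_le_le_0_compat; repeat apply Rmult_le_pos; lra. }
  intros [x y] Hxy. apply unit_circle_iff in Hxy; simpl in Hxy.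
  specialize (HQ x y Hxy). unfold Pfun. fold g.
  replace (dot (x, y) (perp (a, b))) with (x * b - y * a)
    by (unfold dot, perp; simpl; ring).
  set (s := x * b - y * a) in *.
  assert (Hs : s * s <= 1).
  { assert ((a * x + b * y) * (a * x + b * y) + s * s
            = (a * a + b * b) * (x * x + y * y)) by (unfold s; ring).
    rewrite Hn, Hxy in H. pose proof (Rle_0_sqr (a * x + b * y)) as Hc.
    unfold Rsqr in Hc. lra. }
  replace ((g + (4 * g * B + B * B) / (4 * g) * s ^ 2) * g)
    with (g * g + (g * B + B * B / 4) * (s * s)) by (field; lra).
  assert (Hsqrt : g + B * s ^ 2 / 2 <= sqrt (g * g + (g * B + B * B / 4) * (s * s))).
  { rewrite <- (sqrt_square (g + B * s ^ 2 / 2)) by nra. apply sqrt_le_1_alt.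
    assert (0 <= B * B * (s * s) * (1 - s * s)).
    { apply Rmult_le_pos; [| lra]. apply Rmult_le_pos; nra. }
    nra. }
  lra.
Qed.

(** The inequality holds for admissible [alpha] arbitrarily close to [k0 gamma n], or below [k n].
    Comparing squares makes the bound affine in [alpha], so it passes to the limit without the
    infimum being shown to be attained. *)
Lemma Qfun_le_Pfun (gamma k : vec -> R) (n n' : vec) :
  (forall n, unit_circle n -> 3 * gamma n > gamma (opp n)) ->
  C2_off_origin (hom_ext gamma) -> k0 gamma n <= k n ->
  unit_circle n -> unit_circle n' -> Qfun gamma n n' <= Pfun gamma (k n) n n'.
Proof.
  intros H3 HC Hk Hn Hn'.
  assert (Hg := gamma_pos gamma n H3 Hn).
  destruct (stabilizing_exists gamma n H3 HC Hn) as [a0 Ha0].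
  unfold k0 in Hk.
  set (E := fun alpha => 0 <= alpha /\ forall n', unit_circle n' ->
              0 <= Pfun gamma alpha n n' - Qfun gamma n n') in *.
  destruct (Glb_Rbar_correct E) as [Hlb Hglb].
  (* The infimum lies between 0 and [a0], hence is finite, and [real] returns it rather than its
     default value 0. *)
  assert (H0 : Rbar_le 0 (Glb_Rbar E)) by (apply Hglb; intros x Hx; apply Hx).
  specialize (Hlb a0 Ha0) as Hle.
  assert (Happrox : forall eps, 0 < eps ->
            exists alpha, E alpha /\ alpha < k n + eps).
  { intros eps Heps. apply Classical_Prop.NNPP. intros Hno.
    assert (Rbar_le (k n + eps) (Glb_Rbar E)).
    { apply Hglb. intros x Hx. simpl. apply Rnot_lt_le. intros Hlt.
      apply Hno. now exists x. }
    destruct (Glb_Rbar E) as [r | |]; simpl in *; lra. }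
  destruct (Rle_dec (Qfun gamma n n') 0) as [HQ | HQ].
  { apply Rle_trans with (1 := HQ). unfold Pfun.
    apply Rmult_le_pos; [lra | apply sqrt_pos]. }
  set (s := dot n' (perp n)).
  assert (Hsq : (Qfun gamma n n' / 2) ^ 2 <= (gamma n + k n * s ^ 2) * gamma n).
  { apply le_epsilon. intros eps Heps.
    assert (Hsg : 0 <= s ^ 2 * gamma n)
      by (apply Rmult_le_pos; [apply pow2_ge_0 | lra]).
    (* The excess of [alpha] gets multiplied by [s^2 * gamma n]; the added 1 keeps the quotient
       defined when [s = 0]. *)
    destruct (Happrox (eps / (s ^ 2 * gamma n + 1))) as (alpha & [Ha HP] & Hlt).
    { apply Rdiv_lt_0_compat; lra. }
    specialize (HP n' Hn'). unfold Pfun in HP. fold s in HP.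
    assert (Hpos : 0 <= (gamma n + alpha * s ^ 2) * gamma n).
    { apply Rmult_le_pos; [| lra]. pose proof (pow2_ge_0 s). nra. }
    assert (Hsq := pow2_sqrt _ Hpos).
    pose proof (sqrt_pos ((gamma n + alpha * s ^ 2) * gamma n)).
    assert (Halpha : (Qfun gamma n n' / 2) ^ 2 <= (gamma n + alpha * s ^ 2) * gamma n).
    { rewrite <- Hsq. apply pow_incr. lra. }
    assert (alpha * (s ^ 2 * gamma n)
            <= (k n + eps / (s ^ 2 * gamma n + 1)) * (s ^ 2 * gamma n))
      by (apply Rmult_le_compat_r; lra).
    assert (eps / (s ^ 2 * gamma n + 1) * (s ^ 2 * gamma n) <= eps).
    { apply (Rmult_le_reg_r (s ^ 2 * gamma n + 1)); [lra |].
      replace (_ * _ * _) with (eps * (s ^ 2 * gamma n)) by (field; lra). nra. }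
    nra. }
  unfold Pfun. fold s.
  assert (Qfun gamma n n' / 2 <= sqrt ((gamma n + k n * s ^ 2) * gamma n)); [| lra].
  rewrite <- (sqrt_pow2 (Qfun gamma n n' / 2)) by lra. now apply sqrt_le_1_alt.
Qed.

(** * Lumped sums *)

(** A one-sided limit depends only on the values in the open interval, and its uniqueness lets
    [iota] return it. *)
Lemma rlim_ext (f F : R -> R) (a b : R) :
  a < b -> (forall r, a < r < b -> f r = F r) -> continuous F a -> rlim f a = F a.
Proof.
  intros Hab Hf HF.
  apply (iota_filterlim_locally (V := R_CompleteNormedModule) f).
  apply filterlim_ext_loc with (f := F).
  - exists (mkposreal (b - a) ltac:(lra)). intros r Hr Har.
    apply Rabs_def2 in Hr. simpl in Hr. symmetry. apply Hf.
    unfold minus, plus, opp in Hr; simpl in Hr. lra.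
  - apply filterlim_filter_le_1 with (2 := HF). apply filter_le_within.
Qed.

Lemma llim_ext (f F : R -> R) (a b : R) :
  a < b -> (forall r, a < r < b -> f r = F r) -> continuous F b -> llim f b = F b.
Proof.
  intros Hab Hf HF.
  apply (iota_filterlim_locally (V := R_CompleteNormedModule) f).
  apply filterlim_ext_loc with (f := F).
  - exists (mkposreal (b - a) ltac:(lra)). intros r Hr Har.
    apply Rabs_def2 in Hr. simpl in Hr. symmetry. apply Hf.
    unfold minus, plus, opp in Hr; simpl in Hr. lra.
  - apply filterlim_filter_le_1 with (2 := HF). apply filter_le_within.
Qed.

Lemma node_lt (N j : nat) : (1 <= j <= N)%nat -> node N (j - 1) < node N j.
Proof.
  intros Hj. unfold node. apply Rmult_lt_compat_r.
  - apply Rinv_0_lt_compat, lt_0_INR. lia.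
  - apply lt_INR. lia.
Qed.

(** Here [r] lies in [[0, 1)], so [frac_part r = r], and [INR N * r] has integer part [j - 1]; the
    successor in [piecewise] restores the index [j]. *)
Lemma piecewise_eq {V : Type} (N j : nat) (c : nat -> V) (r : R) :
  (1 <= j <= N)%nat -> node N (j - 1) < r < node N j -> piecewise N c r = c j.
Proof.
  intros Hj [Hr1 Hr2].
  assert (HN : 0 < INR N) by (apply lt_0_INR; lia).
  assert (E : forall i, INR N * node N i = INR i).
  { intros i. unfold node. field. lra. }
  apply (Rmult_lt_compat_l (INR N)) in Hr1, Hr2; try exact HN.
  rewrite E in Hr1, Hr2.
  assert (Hj1 : 0 <= INR (j - 1)) by apply pos_INR.
  assert (HjN : INR j <= INR N) by (apply le_INR; lia).
  assert (Hr : 0 <= r < 1) by (split; nra).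
  destruct (Int_part_frac_part_spec r 0 r Hr ltac:(lra)) as [_ Hf].
  unfold piecewise. rewrite <- Hf.
  assert (Hi : Z.of_nat (j - 1) = Int_part (INR N * r)).
  { apply Int_part_spec. rewrite <- INR_IZR_INZ.
    replace j with (S (j - 1)) in Hr2 by lia. rewrite S_INR in Hr2. lra. }
  rewrite <- Hi, Nat2Z.id. f_equal. lia.
Qed.

Lemma sum_n_m_Rext (u v : nat -> R) (n m : nat) :
  (forall j, (n <= j <= m)%nat -> u j = v j) -> sum_n_m u n m = sum_n_m v n m.
Proof. apply (sum_n_m_ext_loc (G := R_AbelianMonoid)). Qed.

(** Removes the one-sided limits: on each edge the integrand agrees with a continuous [F j], whose
    endpoint values are those limits. *)
Lemma lumped_eq (N : nat) (X : R -> vec) (f : R -> R) (F : nat -> R -> R) :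
  (forall j r, (1 <= j <= N)%nat -> node N (j - 1) < r < node N j -> f r = F j r) ->
  (forall j r, continuous (F j) r) ->
  lumped N X f = sum_n_m (fun j => / 2 * (vnorm (edge N X j) *
                   (F j (node N (j - 1)) + F j (node N j)))) 1 N.
Proof.
  intros Hf HF. unfold lumped.
  etransitivity; [symmetry; apply (sum_n_m_mult_l (K := R_Ring)) |].
  apply sum_n_m_Rext. intros j Hj.
  assert (Hlt := node_lt N j Hj).
  rewrite (rlim_ext f (F j) _ (node N j)) by auto.
  rewrite (llim_ext f (F j) (node N (j - 1))) by auto.
  reflexivity.
Qed.

Lemma sum_n_m_telescope (T : nat -> R) (N : nat) :
  sum_n_m (fun j => T j - T (j - 1)%nat) 1 N = T N - T 0%nat.
Proof.
  induction N as [| N IH].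
  - rewrite sum_n_m_zero by lia. symmetry. apply Rminus_diag_eq. reflexivity.
  - rewrite sum_n_Sm by lia. rewrite IH. replace (S N - 1)%nat with N by lia.
    unfold plus; simpl. ring.
Qed.

Lemma sum_n_m_Rplus (u v : nat -> R) (n m : nat) :
  sum_n_m (fun j => u j + v j) n m = sum_n_m u n m + sum_n_m v n m.
Proof. apply (sum_n_m_plus (G := R_AbelianMonoid)). Qed.

Lemma sum_n_m_Rmult (a : R) (u : nat -> R) (n m : nat) :
  sum_n_m (fun j => a * u j) n m = a * sum_n_m u n m.
Proof. apply (sum_n_m_mult_l (K := R_Ring)). Qed.

Lemma sum_n_m_le_loc (u v : nat -> R) (n m : nat) :
  (forall j, (n <= j <= m)%nat -> u j <= v j) -> sum_n_m u n m <= sum_n_m v n m.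
Proof.
  intros H. induction m as [| m IH].
  - destruct n as [| n].
    + rewrite !sum_n_n. apply H. lia.
    + rewrite !sum_n_m_zero by lia. apply Rle_refl.
  - destruct (Compare_dec.le_lt_dec n (S m)) as [Hn | Hn].
    + rewrite !sum_n_Sm by exact Hn. apply Rplus_le_compat; [apply IH | apply H; lia].
      intros j Hj. apply H. lia.
    + rewrite !sum_n_m_zero by lia. apply Rle_refl.
Qed.

(** * Continuity and closure properties of the finite element space *)

Lemma continuous_Rplus (f g : R -> R) (x : R) :
  continuous f x -> continuous g x -> continuous (fun r => f r + g r) x.
Proof. apply (continuous_plus (V := R_NormedModule)). Qed.

Lemma continuous_Rmult (f g : R -> R) (x : R) :
  continuous f x -> continuous g x -> continuous (fun r => f r * g r) x.
Proof. apply (continuous_mult (K := R_AbsRing)). Qed.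

Lemma continuous_Ropp (f : R -> R) (x : R) :
  continuous f x -> continuous (fun r => - f r) x.
Proof. apply (continuous_opp (V := R_NormedModule)). Qed.

Lemma Kh_const (N : nat) (c : R) : Kh N (fun _ => c).
Proof.
  split; [now intros r |]. split; [intros r; apply continuous_const |].
  intros j _. exists c, 0. intros r _. ring.
Qed.

Lemma Kh_minus (N : nat) (u v : R -> R) : Kh N u -> Kh N v -> Kh N (fun r => v r - u r).
Proof.
  intros (Hup & Huc & Hua) (Hvp & Hvc & Hva). split; [| split].
  - intros r. now rewrite (Hup r), (Hvp r).
  - intros r. now apply continuous_Rplus; [| apply continuous_Ropp].
  - intros j Hj. destruct (Hua j Hj) as (a & b & Hu), (Hva j Hj) as (c & d & Hv).
    exists (c - a), (d - b). intros r Hr. rewrite Hu, Hv by exact Hr. ring.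
Qed.

Lemma Kh2_minus (N : nat) (X Y : R -> vec) :
  Kh2 N X -> Kh2 N Y -> Kh2 N (fun r => minus (Y r) (X r)).
Proof.
  intros [HX1 HX2] [HY1 HY2]. split.
  - exact (Kh_minus N _ _ HX1 HY1).
  - exact (Kh_minus N _ _ HX2 HY2).
Qed.

Lemma Kh2_closed (N : nat) (X : R -> vec) :
  (0 < N)%nat -> Kh2 N X -> X (node N N) = X (node N 0).
Proof.
  intros HN [[Hp1 _] [Hp2 _]].
  replace (node N N) with (node N 0 + 1).
  - apply injective_projections; [apply Hp1 | apply Hp2].
  - unfold node. change (INR 0) with 0. field.
    apply Rgt_not_eq, lt_0_INR, HN.
Qed.

(** * The terms of the scheme as sums over edges *)

Definition half_normal_edge (N : nat) (X Y : R -> vec) (j : nat) : vec :=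
  opp (scal (/ (2 * vnorm (edge N X j))) (perp (plus (edge N X j) (edge N Y j)))).

(** The contribution of edge [j] to the lumped product of [n^(m+1/2) . (X^(m+1) - X^m)] with [f].
    This term occurs in both equations of the scheme and links them. *)
Definition edge_flux (N : nat) (X Y : R -> vec) (f : R -> R) (j : nat) : R :=
  / 2 * (vnorm (edge N X j) *
    (f (node N (j - 1)) * dot (half_normal_edge N X Y j)
       (minus (Y (node N (j - 1))) (X (node N (j - 1))))
     + f (node N j) * dot (half_normal_edge N X Y j)
       (minus (Y (node N j)) (X (node N j))))).

(** The factor [c] serves both equations: [/ tau] for the velocity term and 1 for the curvature
    term. *)
Lemma lumped_flux (N : nat) (X Y : R -> vec) (f phi : R -> R) (c : R) :
  Kh2 N X -> Kh2 N Y -> Kh N phi ->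
  (forall r, f r = c * (phi r * dot (half_normal N X Y r) (minus (Y r) (X r)))) ->
  lumped N X f = c * sum_n_m (edge_flux N X Y phi) 1 N.
Proof.
  intros HX HY (_ & Hphi & _) Hf.
  destruct (Kh2_minus N X Y HX HY) as [(_ & H1 & _) (_ & H2 & _)].
  rewrite (lumped_eq N X f (fun j r =>
    c * (phi r * dot (half_normal_edge N X Y j) (minus (Y r) (X r))))).
  - rewrite <- sum_n_m_Rmult. apply sum_n_m_Rext. intros j _. unfold edge_flux. ring.
  - intros j r Hj Hr. rewrite Hf. unfold half_normal. now rewrite (piecewise_eq N j).
  - intros j r. unfold dot.
    apply continuous_Rmult; [apply continuous_const |].
    apply continuous_Rmult; [apply Hphi |].
    apply continuous_Rplus; (apply continuous_Rmult; [apply continuous_const |]).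
    + apply H1.
    + apply H2.
Qed.

Lemma half_double (a b : R) : / 2 * (a * (b + b)) = a * b.
Proof. field. Qed.

Lemma inner_velocity (N : nat) (tau : R) (X Y : R -> vec) (phi : R -> R) :
  Kh2 N X -> Kh2 N Y -> Kh N phi ->
  inner_s N X (fun r => dot (half_normal N X Y r) (scal (/ tau) (minus (Y r) (X r)))) phi
  = / tau * sum_n_m (edge_flux N X Y phi) 1 N.
Proof.
  intros HX HY Hphi. apply lumped_flux; auto. intros r.
  unfold dot, scal; simpl. unfold prod_scal, scal; simpl. unfold mult; simpl. ring.
Qed.

Lemma inner_curvature (N : nat) (X Y : R -> vec) (mu : R -> R) :
  Kh2 N X -> Kh2 N Y -> Kh N mu ->
  inner_v N X (fun r => scal (mu r) (half_normal N X Y r)) (fun r => minus (Y r) (X r))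
  = sum_n_m (edge_flux N X Y mu) 1 N.
Proof.
  intros HX HY Hmu. rewrite <- (Rmult_1_l (sum_n_m _ _ _)).
  apply lumped_flux; auto. intros r.
  unfold dot, scal; simpl. unfold prod_scal, scal; simpl. unfold mult; simpl. ring.
Qed.

Lemma inner_ds (N : nat) (X : R -> vec) (u v : R -> R) :
  inner_s N X (ds N X u) (ds N X v)
  = sum_n_m (fun j => vnorm (edge N X j) *
      (/ vnorm (edge N X j) * (u (node N j) - u (node N (j - 1))) *
       (/ vnorm (edge N X j) * (v (node N j) - v (node N (j - 1)))))) 1 N.
Proof.
  unfold inner_s.
  rewrite (lumped_eq N X _ (fun j _ =>
    (/ vnorm (edge N X j) * (u (node N j) - u (node N (j - 1)))) *
    (/ vnorm (edge N X j) * (v (node N j) - v (node N (j - 1)))))).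
  - apply sum_n_m_Rext. intros j _. apply half_double.
  - intros j r Hj Hr. unfold ds. now rewrite !(piecewise_eq N j).
  - intros j r. apply continuous_const.
Qed.

Lemma inner_elastic (N : nat) (gamma k : vec -> R) (X Y W : R -> vec) :
  inner_v N X (fun r => mulmv (piecewise N (fun j => Gmat gamma k (normal N X j)) r)
                          (ds N X Y r)) (ds N X W)
  = sum_n_m (fun j => vnorm (edge N X j) *
      dot (mulmv (Gmat gamma k (normal N X j))
             (scal (/ vnorm (edge N X j)) (edge N Y j)))
          (scal (/ vnorm (edge N X j)) (edge N W j))) 1 N.
Proof.
  unfold inner_v.
  rewrite (lumped_eq N X _ (fun j _ =>
      dot (mulmv (Gmat gamma k (normal N X j))
             (scal (/ vnorm (edge N X j)) (edge N Y j)))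
          (scal (/ vnorm (edge N X j)) (edge N W j)))).
  - apply sum_n_m_Rext. intros j _. apply half_double.
  - intros j r Hj Hr. unfold ds. now rewrite !(piecewise_eq N j).
  - intros j r. apply continuous_const.
Qed.

Lemma area_increment (N : nat) (X Y : R -> vec) :
  (0 < N)%nat -> Kh2 N X -> Kh2 N Y ->
  (forall j, (1 <= j <= N)%nat -> 0 < vnorm (edge N X j)) ->
  area N Y - area N X = sum_n_m (edge_flux N X Y (fun _ => 1)) 1 N.
Proof.
  intros HN HX HY Hpos.
  (* [T j] is the trapezoid term of [area] for the segment from [X (node N j)] to [Y (node N j)].
     The flux of edge [j] with weight 1 is the signed area of the quadrilateral swept by the edge,
     so the trapezoid terms of its four sides balance; the [T] terms telescope to 0 by
     periodicity. *)
  set (T := fun j : nat => let a := X (node N j) in let c := Y (node N j) in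
    / 2 * (fst c * snd c - fst a * snd a + fst c * snd a - fst a * snd c)).
  assert (HT : T N - T 0%nat = 0).
  { unfold T. rewrite (Kh2_closed N X), (Kh2_closed N Y) by assumption. ring. }
  rewrite <- sum_n_m_telescope in HT.
  unfold area. rewrite <- !sum_n_m_Rmult.
  assert (H : forall a b c d : R, d = 0 -> a = b + c + d -> a - b = c)
    by (intros; lra).
  apply H with (1 := HT). rewrite <- !sum_n_m_Rplus.
  apply sum_n_m_Rext. intros j Hj. specialize (Hpos j Hj). unfold T, edge_flux.
  assert (Hh : vnorm (edge N X j) <> 0) by lra.
  replace (half_normal_edge N X Y j) with
    (scal (/ vnorm (edge N X j)) (opp (scal (/ 2) (perp (plus (edge N X j) (edge N Y j)))))).
  - set (L := vnorm (edge N X j)) in *.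
    unfold edge, dot, scal, minus, plus, opp; simpl.
    unfold prod_scal, prod_plus, prod_opp, scal, plus, opp; simpl.
    unfold mult; simpl. field. exact Hh.
  - unfold half_normal_edge. set (L := vnorm (edge N X j)) in *.
    unfold scal, opp; simpl.
    unfold prod_scal, prod_opp, scal, opp; simpl.
    unfold mult; simpl. f_equal; field; exact Hh.
Qed.

(** * Area and energy *)

Lemma normal_unit (N : nat) (X : R -> vec) (j : nat) :
  0 < vnorm (edge N X j) -> unit_circle (normal N X j).
Proof.
  intros H. apply unit_circle_iff. unfold normal.
  assert (E := vnorm_sq (edge N X j)).
  set (L := vnorm (edge N X j)) in *. set (h := edge N X j) in *.
  change (/ L * - snd h * (/ L * - snd h) + / L * - - fst h * (/ L * - - fst h) = 1).
  replace (_ + _) with ((fst h * fst h + snd h * snd h) / (L * L)) by (field; lra).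
  rewrite <- E. field. lra.
Qed.

Lemma edge_normal (N : nat) (X : R -> vec) (j : nat) :
  0 < vnorm (edge N X j) ->
  edge N X j = scal (vnorm (edge N X j)) (perp (normal N X j)).
Proof.
  intros H. unfold normal.
  set (L := vnorm (edge N X j)) in *. set (h := edge N X j) in *.
  apply injective_projections.
  - change (fst h = L * (/ L * - - fst h)). field. lra.
  - change (snd h = L * - (/ L * - snd h)). field. lra.
Qed.

(** On the pair [(perp n', perp n')] the antisymmetric part of [Gmat] vanishes, leaving [gamma n]
    and the [k] term. On [(perp n', perp n)] the terms with [n . perp n = 0] drop out and exactly
    [Qfun gamma n n' - gamma n'] remains. *)
Lemma Gmat_quadratic (gamma k : vec -> R) (n n' : vec) (L L' : R) :
  unit_circle n' -> L <> 0 ->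
  L * dot (mulmv (Gmat gamma k n) (scal (/ L) (scal L' (perp n'))))
          (scal (/ L) (minus (scal L' (perp n')) (scal L (perp n))))
  = L' ^ 2 / L * (gamma n + k n * dot n' (perp n) ^ 2)
    - L' * (Qfun gamma n n' - gamma n').
Proof.
  intros Hn' HL. apply unit_circle_iff in Hn'.
  destruct n as [a b], n' as [x y]; simpl in Hn'.
  unfold Qfun, Gmat. set (g := gamma (a, b)). set (q := xi gamma (a, b)).
  set (K := k (a, b)). clearbody g q K. destruct q as [q1 q2].
  transitivity (L' ^ 2 / L * (g * (x * x + y * y)
      + K * dot (x, y) (perp (a, b)) ^ 2)
    - L' * (gamma (x, y) + g * dot (a, b) (x, y)
      - dot (q1, q2) (perp (a, b)) * dot (x, y) (perp (a, b)) - gamma (x, y)));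
    [| now rewrite Hn', Rmult_1_r].
  unfold mulmv, outer, id2, dot, scal, minus, plus, opp; simpl.
  unfold prod_scal, prod_plus, prod_opp, scal, plus, opp; simpl.
  unfold prod_scal, prod_plus, prod_opp, scal, plus, opp; simpl.
  unfold mult; simpl. field. exact HL.
Qed.

Lemma energy_edge_le (gamma k : vec -> R) (n n' : vec) (L L' : R) :
  unit_circle n' -> 0 < L -> 0 < L' -> 0 < gamma n -> 0 <= k n ->
  Qfun gamma n n' <= Pfun gamma (k n) n n' ->
  L' * gamma n' - L * gamma n <=
  L * dot (mulmv (Gmat gamma k n) (scal (/ L) (scal L' (perp n'))))
          (scal (/ L) (minus (scal L' (perp n')) (scal L (perp n)))).
Proof.
  intros Hn' HL HL' Hg Hk HQ. rewrite Gmat_quadratic by (assumption || lra).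
  unfold Pfun in HQ. set (u := gamma n + k n * dot n' (perp n) ^ 2) in *.
  assert (Hu : 0 <= u).
  { unfold u. pose proof (pow2_ge_0 (dot n' (perp n))). nra. }
  assert (Hsq : sqrt (u * gamma n) ^ 2 = u * gamma n) by (apply pow2_sqrt; nra).
  set (p := sqrt (u * gamma n)) in *.
  (* AM-GM: [2 L' sqrt (u g) <= L'^2 u / L + L g] *)
  assert (Hamgm : 2 * L' * p <= L' ^ 2 / L * u + L * gamma n).
  { apply (Rmult_le_reg_r (L * gamma n)); [now apply Rmult_lt_0_compat |].
    replace ((L' ^ 2 / L * u + L * gamma n) * (L * gamma n))
      with (L' ^ 2 * (u * gamma n) + (L * gamma n) ^ 2) by (field; lra).
    rewrite <- Hsq. pose proof (pow2_ge_0 (L' * p - L * gamma n)). nra. }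
  assert (L' * Qfun gamma n n' <= L' * (2 * p)) by (apply Rmult_le_compat_l; lra).
  lra.
Qed.

Lemma scheme_step_area (N : nat) (gamma k : vec -> R) (tau : R) (X Y : R -> vec)
    (mu : R -> R) :
  (0 < N)%nat -> 0 < tau -> Kh2 N X -> Kh2 N Y ->
  (forall j, (1 <= j <= N)%nat -> 0 < vnorm (edge N X j)) ->
  scheme_step N gamma k tau X Y mu -> area N Y = area N X.
Proof.
  intros HN Htau HX HY Hpos [Hs _].
  specialize (Hs (fun _ => 1) (Kh_const N 1)).
  rewrite inner_velocity, inner_ds in Hs by (assumption || apply Kh_const).
  rewrite <- area_increment in Hs by assumption.
  (* The arc-length derivative of the constant test function vanishes, so only the area increment
     over [tau] is left. *)
  rewrite (sum_n_m_Rext _ (fun _ => 0)), sum_n_m_const in Hs by (intros; ring).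
  rewrite Rmult_0_r, Rplus_0_r in Hs.
  apply Rmult_integral in Hs. pose proof (Rinv_0_lt_compat tau Htau). lra.
Qed.

(** Both tested equations contain the flux sum [S]: the first reads [S / tau + d = 0] with [d >= 0],
    the second [S = e] with [e] at least the energy increment. Hence the increment is at most
    [S <= 0]. *)
Lemma scheme_step_energy (N : nat) (gamma k : vec -> R) (tau : R) (X Y : R -> vec)
    (mu : R -> R) :
  (forall n, unit_circle n -> 0 < gamma n) ->
  (forall n, unit_circle n -> 0 <= k n) ->
  (forall n n', unit_circle n -> unit_circle n' ->
     Qfun gamma n n' <= Pfun gamma (k n) n n') ->
  0 < tau -> Kh2 N X -> Kh2 N Y -> Kh N mu ->
  (forall j, (1 <= j <= N)%nat -> 0 < vnorm (edge N X j)) ->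
  (forall j, (1 <= j <= N)%nat -> 0 < vnorm (edge N Y j)) ->
  scheme_step N gamma k tau X Y mu -> energy N gamma Y <= energy N gamma X.
Proof.
  intros Hg Hk HPQ Htau HX HY Hmu HposX HposY [Hs1 Hs2].
  specialize (Hs1 mu Hmu).
  specialize (Hs2 _ (Kh2_minus N X Y HX HY)).
  rewrite inner_velocity, inner_ds in Hs1 by assumption.
  rewrite inner_curvature, inner_elastic in Hs2 by assumption.
  set (S := sum_n_m (edge_flux N X Y mu) 1 N) in *.
  match type of Hs1 with _ + ?d = 0 => assert (Hdiss : 0 <= d) end.
  { rewrite <- (Rmult_0_r (INR (Datatypes.S N - 1))), <- sum_n_m_const.
    apply sum_n_m_le_loc. intros j Hj. specialize (HposX j Hj).
    apply Rmult_le_pos; [lra | apply Rle_0_sqr]. }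
  match type of Hs2 with _ - ?e = 0 =>
    assert (Hen : energy N gamma Y + -1 * energy N gamma X <= e) end.
  { unfold energy. rewrite <- sum_n_m_Rmult, <- sum_n_m_Rplus.
    apply sum_n_m_le_loc. intros j Hj.
    specialize (HposX j Hj). specialize (HposY j Hj).
    assert (HnX := normal_unit N X j HposX). assert (HnY := normal_unit N Y j HposY).
    assert (H := energy_edge_le gamma k _ _ _ _ HnY HposX HposY
      (Hg _ HnX) (Hk _ HnX) (HPQ _ _ HnX HnY)).
    rewrite <- !edge_normal in H by assumption.
    replace (edge N (fun r => minus (Y r) (X r)) j)
      with (minus (edge N Y j) (edge N X j)); [apply Rle_trans with (2 := H); lra |].
    apply injective_projections; unfold edge, minus, plus, opp; simpl;
      unfold prod_plus, prod_opp, plus, opp; simpl; ring. }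
  assert (HS : / tau * S <= 0) by lra.
  pose proof (Rinv_0_lt_compat tau Htau). nra.
Qed.

Theorem theorem2p1 :
  forall (gamma k : vec -> R) (N : nat) (tau : R) (Xinit : R -> vec)
         (X : nat -> R -> vec) (mu : nat -> R -> R),
  (forall n : vec, unit_circle n -> 3 * gamma n > gamma (opp n)) ->
  C2_off_origin (hom_ext gamma) ->
  (forall n : vec, unit_circle n -> 0 <= k n) ->
  (forall n : vec, unit_circle n -> k n >= k0 gamma n) ->
  (2 < N)%nat ->
  0 < tau ->
  periodic1 Xinit ->
  (forall r : R, continuous Xinit r) ->
  (forall j : nat, (j <= N)%nat -> X 0%nat (node N j) = Xinit (node N j)) ->
  (forall m : nat, Kh2 N (X m)) ->
  (forall m : nat, Kh N (mu (S m))) ->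
  (forall m : nat, scheme_step N gamma k tau (X m) (X (S m)) (mu (S m))) ->
  (forall m j : nat, (1 <= j <= N)%nat -> 0 < vnorm (edge N (X m) j)) ->
  forall m : nat,
    area N (X (S m)) = area N (X 0%nat) /\
    (forall i : nat, (i <= m)%nat -> energy N gamma (X (S i)) <= energy N gamma (X i)).
Proof.
  intros gamma k N tau Xinit X mu H3 HC Hk Hk0 HN Htau _ _ _ HX Hmu Hstep Hpos m.
  split.
  - assert (Hone : forall i, area N (X (S i)) = area N (X i)).
    { intros i. apply (scheme_step_area N gamma k tau _ _ (mu (S i)));
        auto with arith; lia. }
    induction m as [| m IH]; rewrite Hone; [reflexivity | exact IH].
  - intros i _.
    apply (scheme_step_energy N gamma k tau _ _ (mu (S i))); auto.
    + intros n Hn. now apply gamma_pos.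
    + intros n n' Hn Hn'. apply Qfun_le_Pfun; auto. now apply Rge_le, Hk0.
Qed.
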